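(* Let $M$ be a PTR-submanifold of a Sasakian manifold with totally real distribution $\mathcal D^\perp$ and ambiguous distribution $\widetilde{\mathcal D}$. If the PTR structure is maximal and $\widetilde{\mathcal D}\neq0$, then $\widetilde{\mathcal D}$ is not integrable.
   Context: A Sasakian manifold $(\overline M^{2m+1},\phi,\xi,\eta,g)$ consists of a Riemannian metric $g$ with Levi-Civita connection $\widetilde\nabla$, a $(1,1)$-tensor field $\phi$, a vector field $\xi$ (the Reeb field) and a 1-form $\eta$ with $\phi^2X=-X+\eta(X)\xi$, $\eta(\xi)=1$, $\phi\xi=0$, $g(\phi X,\phi Y)=g(X,Y)-\eta(X)\eta(Y)$ and $(\widetilde\nabla_X\phi)Y=g(X,Y)\xi-\eta(Y)X$; in particular $\widetilde\nabla_X\xi=-\phi X$. Let $M$ be an immersed submanifold with $\xi\in\Gamma(TM)$. For $X\in TM$ write $\phi X=PX+FX$ with $PX$ tangent and $FX$ normal. A PTR (partially totally real) submanifold is such an $M$ with a chosen nonzero constant-rank distribution $\mathcal D^{\perp}\subset TM\cap\ker\eta$ satisfying $\phi\mathcal D^{\perp}\subset T^{\perp}M$. The ambiguous distribution $\widetilde{\mathcal D}$ is the orthogonal complement of $\mathcal D^{\perp}\oplus\langle\xi\rangle$ in $TM$. The PTR structure is maximal if $\mathcal D^{\perp}=\ker(P|_{TM\cap\ker\eta})$. *)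

(* Defs.v *)
From HB Require Import structures.
From mathcomp Require Import all_boot all_order all_algebra.
From mathcomp Require Import all_classical all_reals all_analysis.
Set Implicit Arguments.
Unset Strict Implicit.
Unset Printing Implicit Defensive.
Import Order.TTheory GRing.Theory Num.Theory.
Import numFieldNormedType.Exports.
Local Open Scope classical_set_scope.
Local Open Scope ring_scope.

(* [Ck k U F] : F is of class C^k on U; only meaningful for U open. *)
Fixpoint Ck (R : realType) (V W : normedModType R) (k : nat)
    (U : set V) (F : V -> W) : Prop :=
  match k with
  | 0%N => forall x, U x -> {for x, continuous F}
  | k'.+1 => (forall x, U x -> differentiable F x) /\
             forall v : V, Ck k' U (fun x => 'd F x v)
  end.

Definition smooth_near (R : realType) (V W : normedModType R)
    (F : V -> W) (x : V) : Prop :=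
  exists U : set V, [/\ open U, U x & forall k, Ck k U F].

(* A smooth n-manifold (Hausdorff, second countable, without boundary), given
   by an atlas indexed by the points: [chart p] is a chart around p with domain
   [dom p] and inverse [cinv p].  Every smooth structure has such an atlas and
   every such atlas determines a smooth structure.  The values of [chart p]
   outside [dom p] and of [cinv p] outside the image of the chart are junk. *)
Record manifold (R : realType) (n : nat) := Manifold {
  carrier :> topologicalType;
  hausdorff_carrier : hausdorff_space carrier;
  second_countable_carrier : @second_countable carrier;
  dom : carrier -> set carrier;
  chart : carrier -> carrier -> 'rV[R]_n;
  cinv : carrier -> 'rV[R]_n -> carrier;
  dom_open : forall p, open (dom p);
  dom_center : forall p, dom p p;
  image_open : forall p, open (chart p @` dom p);
  chartK : forall p x, dom p x -> cinv p (chart p x) = x;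
  chart_continuous : forall p x, dom p x -> {for x, continuous (chart p)};
  cinv_continuous : forall p y, (chart p @` dom p) y ->
    {for y, continuous (cinv p)};
  transition_smooth : forall p q k,
    Ck k (chart p @` (dom p `&` dom q)) (chart q \o cinv p)
}.
Arguments dom {R n m} : rename.
Arguments chart {R n m} : rename.
Arguments cinv {R n m} : rename.

(* The tangent space at p is identified with R^n by means of [chart p]: the
   vector v stands for the velocity at p of t |-> cinv p (chart p p + t v).
   Hence a vector field is a function M -> 'rV_n, its value at p being read in
   [chart p], and the coordinates in [chart p] of its value at q are obtained
   by applying the differential at [chart q q] of the transition map. *)
Definition vfield (R : realType) (n : nat) (M : manifold R n) : Type :=
  M -> 'rV[R]_n.

Section Calculus.
Context {R : realType}.

Definition smooth_fun_at n (M : manifold R n) (h : M -> R) (p : M) : Prop :=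
  smooth_near (h \o cinv p) (chart p p).

Definition dfun n (M : manifold R n) (h : M -> R) (p : M) (v : 'rV[R]_n) : R :=
  'd (h \o cinv p) (chart p p) v.

Definition vrep n (M : manifold R n) (X : vfield M) (p : M) (y : 'rV[R]_n) :
    'rV[R]_n :=
  let q := cinv p y in 'd (chart p \o cinv q) (chart q q) (X q).

Definition smooth_field_at n (M : manifold R n) (X : vfield M) (p : M) : Prop :=
  smooth_near (vrep X p) (chart p p).

(* Lie bracket of vector fields: DY(X) - DX(Y) in the chart at p. *)
Definition bracket n (M : manifold R n) (X Y : vfield M) : vfield M := fun p =>
  'd (vrep Y p) (chart p p) (X p) - 'd (vrep X p) (chart p p) (Y p).

Definition loc n k (M : manifold R n) (N : manifold R k) (f : M -> N) (p : M) :
    'rV[R]_n -> 'rV[R]_k :=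
  chart (f p) \o f \o cinv p.

Definition smooth_map n k (M : manifold R n) (N : manifold R k) (f : M -> N) :
    Prop :=
  continuous f /\ forall p, smooth_near (loc f p) (chart p p).

Definition tmap n k (M : manifold R n) (N : manifold R k) (f : M -> N) (p : M)
    (v : 'rV[R]_n) : 'rV[R]_k :=
  'd (loc f p) (chart p p) v.

Definition immersion n k (M : manifold R n) (N : manifold R k) (f : M -> N) :
    Prop :=
  smooth_map f /\ forall p, injective (tmap f p).

(* D is a smooth distribution of constant rank r. *)
Definition distribution n (M : manifold R n) (r : nat)
    (D : M -> {vspace 'rV[R]_n}) : Prop :=
  forall p : M, exists X : 'I_r -> vfield M,
    (forall i, smooth_field_at (X i) p) /\
    \forall q \near p, basis_of (D q) [tuple X i q | i < r].

(* Through every point there passes an integral manifold of D, i.e. an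
   injectively immersed manifold whose tangent spaces are exactly those of D. *)
Definition integrable_distribution n (M : manifold R n)
    (D : M -> set 'rV[R]_n) : Prop :=
  forall p : M, exists (k : nat) (N : manifold R k) (i : N -> M) (q0 : N),
    [/\ immersion i, injective i, i q0 = p &
        forall q, range (tmap i q) = D (i q)].

End Calculus.

Record riemannian_metric (R : realType) (n : nat) (M : manifold R n)
    (g : M -> 'rV[R]_n -> 'rV[R]_n -> R) : Prop := RiemannianMetric {
  metric_linear : forall p w a u v,
    g p (a *: u + v) w = a * g p u w + g p v w;
  metric_sym : forall p u v, g p u v = g p v u;
  metric_pos : forall p u, u != 0 -> 0 < g p u u;
  metric_smooth : forall p (X Y : vfield M),
    smooth_field_at X p -> smooth_field_at Y p ->
    smooth_fun_at (fun q => g q (X q) (Y q)) p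
}.

(* [nabla Y p v] is the covariant derivative of Y at p in the direction v.  It
   is constrained only when Y is smooth on a neighbourhood of p. *)
Record levi_civita (R : realType) (n : nat) (M : manifold R n)
    (g : M -> 'rV[R]_n -> 'rV[R]_n -> R)
    (nabla : vfield M -> forall p : M, 'rV[R]_n -> 'rV[R]_n) : Prop :=
  LeviCivita {
  nabla_linear : forall (Y : vfield M) p a u v, smooth_field_at Y p ->
    nabla Y p (a *: u + v) = a *: nabla Y p u + nabla Y p v;
  nabla_add : forall (Y Z : vfield M) p v,
    smooth_field_at Y p -> smooth_field_at Z p ->
    nabla (fun q => Y q + Z q) p v = nabla Y p v + nabla Z p v;
  nabla_leibniz : forall (h : M -> R) (Y : vfield M) p v,
    smooth_fun_at h p -> smooth_field_at Y p ->
    nabla (fun q => h q *: Y q) p v = dfun h p v *: Y p + h p *: nabla Y p v;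
  nabla_smooth : forall (X Y : vfield M) p,
    smooth_field_at X p -> smooth_field_at Y p ->
    smooth_field_at (fun q => nabla Y q (X q)) p;
  nabla_torsion_free : forall (X Y : vfield M) p,
    smooth_field_at X p -> smooth_field_at Y p ->
    nabla Y p (X p) - nabla X p (Y p) = bracket X Y p;
  nabla_metric : forall (Y Z : vfield M) p v,
    smooth_field_at Y p -> smooth_field_at Z p ->
    dfun (fun q => g q (Y q) (Z q)) p v =
      g p (nabla Y p v) (Z p) + g p (Y p) (nabla Z p v)
}.

Record sasakian (R : realType) (n : nat) (M : manifold R n) := Sasakian {
  phi : M -> {linear 'rV[R]_n -> 'rV[R]_n};
  xi : vfield M;
  eta : M -> {scalar 'rV[R]_n};
  g : M -> 'rV[R]_n -> 'rV[R]_n -> R;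
  nabla : vfield M -> forall p : M, 'rV[R]_n -> 'rV[R]_n;
  g_metric : riemannian_metric g;
  nabla_levi_civita : levi_civita g nabla;
  phi_smooth : forall p (X : vfield M),
    smooth_field_at X p -> smooth_field_at (fun q => phi q (X q)) p;
  xi_smooth : forall p, smooth_field_at xi p;
  eta_smooth : forall p (X : vfield M),
    smooth_field_at X p -> smooth_fun_at (fun q => eta q (X q)) p;
  phi_phi : forall p u, phi p (phi p u) = - u + eta p u *: xi p;
  eta_xi : forall p, eta p (xi p) = 1;
  phi_xi : forall p, phi p (xi p) = 0;
  g_phi : forall p u v,
    g p (phi p u) (phi p v) = g p u v - eta p u * eta p v;
  (* left-hand side: (nabla_v phi) Y at p *)
  nabla_phi : forall (Y : vfield M) p v, smooth_field_at Y p ->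
    nabla (fun q => phi q (Y q)) p v - phi p (nabla Y p v) =
      g p v (Y p) *: xi p - eta p (Y p) *: v
}.

(* In the rest of the file, M is immersed in the Sasakian manifold N by f. *)
Section Submanifold.
Context {R : realType} {k n : nat} {N : manifold R k} {M : manifold R n}.
Context (S : sasakian N) (f : M -> N).

Definition is_normal (p : M) (u : 'rV[R]_k) : Prop :=
  forall w, g S (f p) u (tmap f p w) = 0.

Definition xi_tangent : Prop :=
  forall p, exists v, tmap f p v = xi S (f p).

Definition horizontal (p : M) (v : 'rV[R]_n) : Prop :=
  eta S (f p) (tmap f p v) = 0.

(* The orthogonal projection to T_pM: the w, unique when f is an immersion,
   such that u - df_p w is normal. *)
Definition tangent_part (p : M) (u : 'rV[R]_k) : 'rV[R]_n :=
  xget 0 [set w | is_normal p (u - tmap f p w)].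

Definition Pmap (p : M) (v : 'rV[R]_n) : 'rV[R]_n :=
  tangent_part p (phi S (f p) (tmap f p v)).

Record ptr_submanifold (Dperp : M -> {vspace 'rV[R]_n}) : Prop :=
  PtrSubmanifold {
  ptr_immersion : immersion f;
  ptr_xi_tangent : xi_tangent;
  ptr_distribution : exists2 r, (0 < r)%N & distribution r Dperp;
  ptr_horizontal : forall p v, v \in Dperp p -> horizontal p v;
  ptr_totally_real : forall p v, v \in Dperp p ->
    is_normal p (phi S (f p) (tmap f p v))
}.

Definition ptr_maximal (Dperp : M -> {vspace 'rV[R]_n}) : Prop :=
  forall p v, v \in Dperp p <-> horizontal p v /\ Pmap p v = 0.

Definition ambiguous (Dperp : M -> {vspace 'rV[R]_n}) (p : M) :
    set 'rV[R]_n :=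
  [set v | g S (f p) (tmap f p v) (xi S (f p)) = 0 /\
           forall w, w \in Dperp p ->
             g S (f p) (tmap f p v) (tmap f p w) = 0].

End Submanifold.

(* Main.v *)
Require Import Defs.
From HB Require Import structures.
From mathcomp Require Import all_boot all_order all_algebra.
From mathcomp Require Import all_classical all_reals all_analysis.
Import Order.TTheory GRing.Theory Num.Theory.
Import numFieldNormedType.Exports.
Local Open Scope classical_set_scope.
Local Open Scope ring_scope.
Set Implicit Arguments.
Unset Strict Implicit.
Unset Printing Implicit Defensive.
Import Defs.

(** Write D for the ambiguous distribution, and suppose that an integral
manifold [i : L -> M] of D passes through p.  Since D is orthogonal to xi and
eta = g(-, xi), the form eta vanishes on all vectors tangent to [f \o i]; so
its pullback to L is zero, hence so is the pullback of d eta
([dform_integral]).  On a Sasakian manifold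
d eta(v, w) = - 2 g(phi v, w) for v, w in the kernel of eta ([d_eta]).
Therefore phi v is orthogonal to D_p for every v in D_p.  It is also orthogonal
to xi, and to D^perp because phi is skew and maps D^perp to the normal bundle.
As T_pM = D_p + D^perp_p + <xi> ([tangent_split]), phi v is normal to M, that
is, P v = 0, so maximality puts v in D^perp_p; being orthogonal to
D^perp_p, it is zero ([ambiguous_not_isotropic]).

All of this is read in charts.  The formula for d eta follows from the
Levi-Civita axioms applied to the fields that are constant in a chart: they
commute, so only the covariant derivative of xi is left, and the Sasakian
condition at Y = xi determines it up to a multiple of xi.  That the exterior
derivative commutes with pullback reduces to the symmetry of second
differentials ([diff_diff_sym]).  Naturality is applied to f and to i
separately, so that second derivatives of [f \o i] never occur. *)

(** * Differentials and the symmetry of second derivatives *)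

Section Differentials.
Context {R : realType}.

Lemma near_eq_differentiable (V W : normedModType R) (f h : V -> W) (x : V) :
  (\forall y \near x, f y = h y) -> differentiable f x -> differentiable h x.
Proof.
move=> fh df; have fhx := nbhs_singleton fh.
have e : h \o shift x = cst (h x) + 'd f x +o_ (0 : V) id.
  apply/eqaddoP => e e0.
  have /eqaddoP/(_ e e0) H : f \o shift x = cst (f x) + 'd f x +o_ (0 : V) id.
    exact: diff_locally.
  have fh0 : \forall y \near (0 : V), f (y + x) = h (y + x).
    by rewrite (near_shift x); apply: filterS fh => z /=; rewrite sub0r subrK.
  near=> y.
  have -> : ((h \o shift x) - (cst (h x) + 'd f x)) y =
           ((f \o shift x) - (cst (f x) + 'd f x)) y.
    rewrite !fctE /= -fhx; congr (_ - _); symmetry; near: y; exact: fh0.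
  by near: y.
have dh := diff_unique (diff_continuous df) e.
apply/diff_locallyP; rewrite dh; split => //; exact: diff_continuous.
Unshelve. all: by end_near. Qed.

Lemma near_eq_diff (V W : normedModType R) (f h : V -> W) (x : V) :
  (\forall y \near x, f y = h y) -> differentiable f x ->
  'd h x = 'd f x :> (V -> W).
Proof.
move=> fh df; have dh := near_eq_differentiable fh df.
by apply/funext => v; rewrite -!deriveE//; apply/esym/near_eq_derive.
Qed.

Lemma diff_near_cst (V W : normedModType R) (f : V -> W) (c : W) (x v : V) :
  (\forall y \near x, f y = c) -> differentiable f x /\ 'd f x v = 0.
Proof.
move=> fc; have e : \forall y \near x, cst c y = f y by apply: filterS fc => y ->.
split; first exact: near_eq_differentiable e _.
have /(congr1 (@^~ v)) := near_eq_diff e (differentiable_cst c x) => ->.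
by have /(congr1 (@^~ v)) := diff_cst c x.
Qed.

Lemma chain_rule (U V W : normedModType R) (F : U -> V) (G : V -> W) (H : U -> W)
    (x : U) (y : V) :
  F x = y -> differentiable F x -> differentiable G y ->
  (\forall z \near x, G (F z) = H z) ->
  differentiable H x /\ forall v, 'd H x v = 'd G y ('d F x v).
Proof.
move=> <- dF dG GFH; have dGF := differentiable_comp dF dG.
split; first exact: near_eq_differentiable GFH dGF.
by move=> v; have /(congr1 (@^~ v)) := near_eq_diff GFH dGF => ->; rewrite diff_comp.
Qed.

Lemma is_derive_line (V W : normedModType R) (f : V -> W) (y v : V) (s : R) (l : W) :
  is_derive (s *: v + y) v f l ->
  is_derive s 1 (fun r => f (r *: v + y)) l.
Proof.
move=> [df <-].
have e : (fun h : R => h^-1 *: (((fun r => f (r *: v + y)) \o shift s) (h *: 1) - f (s *: v + y)))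
   = (fun h : R => h^-1 *: ((f \o shift (s *: v + y)) (h *: v) - f (s *: v + y))).
  apply/funext => h /=; do 3 f_equal.
  by rewrite scalerDl -addrA [h *: 1]mulr1.
by apply: DeriveDef; [rewrite /derivable e|rewrite /derive e].
Qed.

(** The mean value theorem is applied first in the direction v and then, at the
intermediate point, in the direction w.  The left-hand side is symmetric in v
and w, so some value of one mixed derivative near x equals some value of the
other near x. *)
Lemma second_difference (V : normedModType R) (f fv fvw : V -> R) (x v w : V) (t : R) :
  0 < t ->
  (forall a b, 0 <= a <= t -> 0 <= b <= t ->
     is_derive (a *: v + (b *: w + x)) v f (fv (a *: v + (b *: w + x))) /\
     is_derive (b *: w + (a *: v + x)) w fv (fvw (b *: w + (a *: v + x)))) ->
  exists a b, [/\ 0 <= a <= t, 0 <= b <= t &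
    f (t *: v + (t *: w + x)) - f (t *: v + x) - f (t *: w + x) + f x =
    t ^+ 2 * fvw (b *: w + (a *: v + x))].
Proof.
move=> t0 H.
have t00 : 0 <= t <= t by rewrite lexx ltW.
have z0t : 0 <= (0 : R) <= t by rewrite lexx ltW.
pose k s := f (s *: v + (t *: w + x)) - f (s *: v + x).
pose dk s := fv (s *: v + (t *: w + x)) - fv (s *: v + x).
have kD s : 0 <= s <= t -> is_derive s 1 k (dk s).
  move=> st; apply: is_deriveB; apply: is_derive_line; first exact: (H s t st t00).1.
  by have := (H s 0 st z0t).1; rewrite scale0r add0r.
have [||a /itvP ast ka] := @MVT R k dk 0 t t0.
- by move=> s /itvP st; apply: kD; rewrite !st.
- apply: derivable_within_continuous => s /itvP st.
  by apply: @ex_derive; apply: kD; rewrite !st.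
have as' : 0 <= a <= t by rewrite !ast.
pose l s := fv (s *: w + (a *: v + x)).
pose dl s := fvw (s *: w + (a *: v + x)).
have lD s : 0 <= s <= t -> is_derive s 1 l (dl s).
  by move=> st; apply: is_derive_line; exact: (H a s as' st).2.
have [||b /itvP bst lb] := @MVT R l dl 0 t t0.
- by move=> s /itvP st; apply: lD; rewrite !st.
- apply: derivable_within_continuous => s /itvP st.
  by apply: @ex_derive; apply: lD; rewrite !st.
exists a, b; split; rewrite ?bst//.
move: ka lb; rewrite /k /dk /l /dl !scale0r !add0r !subr0.
rewrite [t *: w + (a *: v + x)]addrCA => kE lE.
rewrite expr2 -mulrA mulrC -[t * fvw _]mulrC -lE -kE opprB addrAC -!addrA.
by congr (_ + _); rewrite addrCA addrC -addrA.
Qed.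

(** Schwarz's theorem. *)
Lemma mixed_derivatives_eq (V : normedModType R) (f fv fw fvw fwv : V -> R)
    (x v w : V) :
  (\forall y \near x, is_derive y v f (fv y) /\ is_derive y w fv (fvw y)) ->
  (\forall y \near x, is_derive y w f (fw y) /\ is_derive y v fw (fwv y)) ->
  {for x, continuous fvw} -> {for x, continuous fwv} -> fvw x = fwv x.
Proof.
move=> Hv Hw cv cw; apply/eqP; rewrite -subr_eq0 -normr_le0; apply/ler_addgt0Pl => e e0.
rewrite addr0.
have e2 : 0 < e / 2 by rewrite divr_gt0.
have {}cv : \forall y \near x, `|fvw x - fvw y| < e / 2.
  by move/cvgrPdist_lt : cv; apply.
have {}cw : \forall y \near x, `|fwv x - fwv y| < e / 2.
  by move/cvgrPdist_lt : cw; apply.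
have /nbhs_ballP[d /= d0 B] : \forall y \near x, [/\ is_derive y v f (fv y) /\ is_derive y w fv (fvw y),
   is_derive y w f (fw y) /\ is_derive y v fw (fwv y), `|fvw x - fvw y| < e / 2
   & `|fwv x - fwv y| < e / 2].
  by near=> y; split; near: y.
(* With this step the whole parallelogram spanned by t v and t w at x stays in
   the ball of radius d. *)
pose t := d / (`|v| + `|w| + 1).
have n0 : 0 < `|v| + `|w| + 1 by rewrite ltr_pwDr// addr_ge0.
have t0 : 0 < t by rewrite divr_gt0.
have near_x a b : 0 <= a <= t -> 0 <= b <= t -> ball x d (a *: v + (b *: w + x)).
  move=> /andP[a0 at_] /andP[b0 bt].
  rewrite -ball_normE /= addrA opprD addrCA subrr addr0 normrN.
  rewrite (le_lt_trans (ler_normD _ _))// !normrZ !ger0_norm//.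
  rewrite (@le_lt_trans _ _ (t * (`|v| + `|w|)))//.
    by rewrite mulrDr lerD// ler_wpM2r.
  by rewrite /t mulrAC ltr_pdivrMr// ltr_pM2l// ltrDl.
have [a [b [a_ b_ E1]]] : exists a b, [/\ 0 <= a <= t, 0 <= b <= t &
    f (t *: v + (t *: w + x)) - f (t *: v + x) - f (t *: w + x) + f x =
    t ^+ 2 * fvw (b *: w + (a *: v + x))].
  apply: (@second_difference _ f fv fvw) => // a b a_ b_; split.
    by have [[]] := B _ (near_x _ _ a_ b_).
  by rewrite addrCA; have [[]] := B _ (near_x _ _ a_ b_).
have [a' [b' [a'_ b'_ E2]]] : exists a b, [/\ 0 <= a <= t, 0 <= b <= t &
    f (t *: w + (t *: v + x)) - f (t *: w + x) - f (t *: v + x) + f x =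
    t ^+ 2 * fwv (b *: v + (a *: w + x))].
  apply: (@second_difference _ f fw fwv) => // a' b' a'_ b'_; split.
    by rewrite addrCA; have [_ []] := B _ (near_x _ _ b'_ a'_).
  by have [_ []] := B _ (near_x _ _ b'_ a'_).
have : t ^+ 2 * fvw (b *: w + (a *: v + x)) = t ^+ 2 * fwv (b' *: v + (a' *: w + x)).
  by rewrite -E1 -E2 addrCA; congr (_ + _); rewrite addrAC.
have t2 : t ^+ 2 != 0 by rewrite expf_neq0// gt_eqF.
move/(mulfI t2) => E.
have [_ _ + _] := B _ (near_x _ _ a_ b_); rewrite addrCA E => F1.
have [_ _ _ F2] := B _ (near_x _ _ b'_ a'_).
rewrite -(subrKA (fwv (b' *: v + (a' *: w + x)))) (splitr e).
by rewrite (le_trans (ler_normD _ _))// lerD// ltW// distrC.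
Unshelve. all: by end_near. Qed.

Lemma is_derive_coord (V : normedModType R) k (F : V -> 'rV[R]_k) (y v : V) j :
  differentiable F y -> is_derive y v (fun z => F z 0 j) ('d F y v 0 j).
Proof.
move=> dF; have dv := diff_derivable (v := v) dF.
apply: DeriveDef; first exact: (derivable_mxP _ _ _).1.
by rewrite -deriveE// derive_mx// mxE.
Qed.

Lemma diff_diff_sym (V : normedModType R) k (U : set V) (F : V -> 'rV[R]_k)
    (x v w : V) : open U -> U x -> Ck 2 U F ->
  'd (fun y => 'd F y v) x w = 'd (fun y => 'd F y w) x v.
Proof.
move=> oU Ux [dF cF]; apply/rowP => j.
apply: (@mixed_derivatives_eq _ (fun y => F y 0 j) (fun y => 'd F y v 0 j)
  (fun y => 'd F y w 0 j) (fun y => 'd (fun y => 'd F y v) y w 0 j)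
  (fun y => 'd (fun y => 'd F y w) y v 0 j)).
- near=> y; have Uy : U y by near: y; exact: open_nbhs_nbhs.
  split; apply: is_derive_coord; first exact: dF.
  exact: (cF v).1.
- near=> y; have Uy : U y by near: y; exact: open_nbhs_nbhs.
  split; apply: is_derive_coord; first exact: dF.
  exact: (cF w).1.
- have := (cF v).2 w x Ux => c.
  exact: (continuous_comp c (@coord_continuous _ _ _ _ _ _)).
- have := (cF w).2 v x Ux => c.
  exact: (continuous_comp c (@coord_continuous _ _ _ _ _ _)).
Unshelve. all: by end_near. Qed.

End Differentials.

(** * One-forms on coordinate spaces *)

Section OneForms.
Context {R : realType}.

Definition form_pull n k (F : 'rV[R]_n -> 'rV[R]_k) (a : 'rV[R]_k -> {scalar 'rV[R]_k}) :
    'rV[R]_n -> {scalar 'rV[R]_n} :=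
  fun z => (a (F z) \o 'd F z : {scalar 'rV[R]_n}).

Definition differentiable_form k (a : 'rV[R]_k -> {scalar 'rV[R]_k}) (y : 'rV[R]_k) : Prop :=
  forall u, differentiable (fun z => a z u) y.

(** The exterior derivative, evaluated on the constant fields v and w. *)
Definition dform k (a : 'rV[R]_k -> {scalar 'rV[R]_k}) (y v w : 'rV[R]_k) : R :=
  'd (fun z => a z w) y v - 'd (fun z => a z v) y w.

Lemma scalar_sum k (l : {scalar 'rV[R]_k}) u :
  l u = \sum_j u 0 j * l (delta_mx 0 j).
Proof.
by rewrite {1}(row_sum_delta u) linear_sum; apply: eq_bigr => j _; rewrite linearZ.
Qed.

Lemma diff_form_eval k (a : 'rV[R]_k -> {scalar 'rV[R]_k}) y u h :
  differentiable_form a y ->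
  'd (fun z => a z u) y h = \sum_j u 0 j * 'd (fun z => a z (delta_mx 0 j)) y h.
Proof.
move=> da; rewrite -deriveE; last exact: da.
have -> : (fun z => a z u) = \sum_j (u 0 j *: (fun z => (a z (delta_mx 0 j) : R))).
  by apply/funext => z; rewrite fct_sumE scalar_sum.
rewrite derive_sum; last by move=> j; apply/derivableZ/diff_derivable/da.
apply: eq_bigr => j _; rewrite deriveZ ?deriveE//; exact/diff_derivable/da.
Qed.

(** The product rule for the pairing of a one-form along F with a vector
field G along F, obtained by expanding in coordinates. *)
Lemma differentiable_pairing n k (F G : 'rV[R]_n -> 'rV[R]_k)
    (a : 'rV[R]_k -> {scalar 'rV[R]_k}) (z : 'rV[R]_n) :
  differentiable F z -> differentiable G z -> differentiable_form a (F z) ->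
  differentiable (fun x => a (F x) (G x)) z /\
  (forall w, 'd (fun x => a (F x) (G x)) z w =
    a (F z) ('d G z w) + 'd (fun y => a y (G z)) (F z) ('d F z w)).
Proof.
move=> dF dG da.
pose Gj j (x : 'rV[R]_n) : R := G x 0 j.
pose aj j (x : 'rV[R]_n) : R := a (F x) (delta_mx 0 j).
have cE : (fun x => (a (F x) (G x) : R)) = \sum_j (Gj j * aj j).
  by apply/funext => x; rewrite fct_sumE scalar_sum.
have dGj j : differentiable (Gj j) z.
  exact: (@differentiable_comp _ _ _ _ G (fun A : 'rV[R]_k => A 0 j) _ dG
    (differentiable_coord _ _ _)).
have daj j : differentiable (aj j) z.
  by apply: (@differentiable_comp _ _ _ _ F (fun y => (a y (delta_mx 0 j) : R))).
have dc j : differentiable (Gj j * aj j) z by exact: differentiableM.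
have ds : differentiable (fun x => (a (F x) (G x) : R)) z.
  by rewrite cE; apply: differentiable_sum.
split=> // w.
have GE j : 'D_w (Gj j) z = 'd G z w 0 j by have [] := is_derive_coord w j dG.
have aE j : 'D_w (aj j) z =
    'd (fun y => (a y (delta_mx 0 j) : R)) (F z) ('d F z w).
  rewrite deriveE//.
  by have /(congr1 (@^~ w)) := diff_comp dF (da (delta_mx 0 j)).
rewrite -deriveE// [in LHS]cE derive_sum; last by move=> j; exact: diff_derivable.
rewrite diff_form_eval// [a (F z) _]scalar_sum -big_split/=.
apply: eq_bigr => j _.
rewrite deriveM; [|exact: diff_derivable..].
by rewrite GE aE addrC; congr (_ + _); apply: (mulrC (aj j z)).
Qed.

Lemma differentiable_form_pull n k (F : 'rV[R]_n -> 'rV[R]_k) a z :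
  differentiable F z -> (forall v, differentiable (fun x => 'd F x v) z) ->
  differentiable_form a (F z) -> differentiable_form (form_pull F a) z.
Proof. by move=> dF ddF da v; exact: (differentiable_pairing dF (ddF v) da).1. Qed.

(** The two terms of [dform] that involve second differentials of F cancel by
symmetry. *)
Lemma dform_pull n k (F : 'rV[R]_n -> 'rV[R]_k) a z v w :
  differentiable F z -> (forall v, differentiable (fun x => 'd F x v) z) ->
  'd (fun y => 'd F y v) z w = 'd (fun y => 'd F y w) z v ->
  differentiable_form a (F z) ->
  dform (form_pull F a) z v w = dform a (F z) ('d F z v) ('d F z w).
Proof.
move=> dF ddF sym da; rewrite /dform.
have E u t : 'd (fun x => form_pull F a x t) z u =
    a (F z) ('d (fun x => 'd F x t) z u) +
    'd (fun y => a y ('d F z t)) (F z) ('d F z u) :=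
  (differentiable_pairing dF (ddF t) da).2 u.
rewrite (E v w) (E w v).
have cancel (p q r s : R) : r = s -> (r + p) - (s + q) = p - q.
  by move=> ->; rewrite opprD addrACA subrr add0r.
exact/cancel/congr1/esym.
Qed.
End OneForms.

(** * Changes of charts *)

Section Charts.
Context {R : realType}.

Section OneManifold.
Context {n : nat} {M : manifold R n}.
Implicit Types p q x : M.

Lemma nbhs_dom p x : dom p x -> nbhs x (dom p).
Proof. by move=> px; apply: open_nbhs_nbhs; split; [exact: dom_open|]. Qed.

(** Any local property of the manifold can be read in a chart; for a
change of charts, A is the domain of the second chart. *)
Lemma near_cinv p x (A : set M) : dom p x -> nbhs x A ->
  \forall y \near chart p x,
    [/\ dom p (cinv p y), chart p (cinv p y) = y & A (cinv p y)].
Proof.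
move=> px Ax.
have imy : \forall y \near chart p x, (chart p @` dom p) y.
  by apply: open_nbhs_nbhs; split; [exact: image_open|exists x].
have cc : {for chart p x, continuous (cinv p)}.
  by apply: cinv_continuous; exists x.
have Ay : \forall y \near chart p x, A (cinv p y).
  by apply: cc; rewrite chartK.
near=> y; have : (chart p @` dom p) y by near: y.
move=> [z pz yE]; have cE : cinv p y = z by rewrite -yE chartK.
by split; [rewrite cE|rewrite cE|near: y].
Unshelve. all: by end_near. Qed.

(** Converts the coordinates of a tangent vector at x from the chart at p to
the chart at q.  The transition maps are inverse to each other near x, so
their differentials are too. *)
Definition trans p q x : {linear 'rV[R]_n -> 'rV[R]_n} :=
  'd (chart q \o cinv p) (chart p x).

Lemma trans_differentiable p q x : dom p x -> dom q x ->
  differentiable (chart q \o cinv p) (chart p x).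
Proof.
by move=> px qx; apply: (transition_smooth p q 1).1; exists x.
Qed.

Lemma transK p q x : dom p x -> dom q x -> cancel (trans p q x) (trans q p x).
Proof.
move=> px qx v.
have dpq := trans_differentiable px qx.
have E : (chart q \o cinv p) (chart p x) = chart q x by rewrite /= chartK.
have dqp := trans_differentiable qx px.
have idE : \forall y \near chart p x,
   (chart p \o cinv q) ((chart q \o cinv p) y) = id y.
  by apply: filterS (near_cinv px (nbhs_dom qx)) => y [_ yE qy] /=; rewrite chartK.
have [_ tE] := chain_rule E dpq dqp idE.
have /(_ (chart p x)) [_ idv] := @is_diff_id R 'rV[R]_n.
rewrite /trans; apply: etrans (esym (tE v)) _.
exact: (congr1 (@^~ v) idv).
Qed.

End OneManifold.

Lemma loc_differentiable n k (M : manifold R n) (N : manifold R k) (f : M -> N) p :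
  smooth_map f -> differentiable (loc f p) (chart p p).
Proof. by move=> [_ /(_ p)[U [oU Up]]] /(_ 1%N)[+ _]; apply. Qed.

(** [tmap f q] is read in the charts centred at q and f q; here it is compared
with the differential at q of the expression of f in the charts centred at
p and f p. *)
Lemma diff_loc n k (M : manifold R n) (N : manifold R k) (f : M -> N) p q v :
  smooth_map f -> dom p q -> dom (f p) (f q) ->
  'd (loc f p) (chart p q) v = trans (f q) (f p) (f q) (tmap f q (trans p q q v)).
Proof.
move=> sf pq fpq; have qq := dom_center q; have fqq := dom_center (f q).
have E1 : cinv p (chart p q) = q by rewrite chartK.
have E2 : cinv q (chart q q) = q by rewrite chartK.
have d1 := trans_differentiable pq qq.
have d2 : differentiable (loc f q) ((chart q \o cinv p) (chart p q)).
  by rewrite /= E1; exact: loc_differentiable.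
have d3 : differentiable (chart (f p) \o cinv (f q))
    ((loc f q \o (chart q \o cinv p)) (chart p q)).
  by rewrite /loc /= E1 E2; exact: trans_differentiable.
have d12 := differentiable_comp d1 d2.
have eqF : \forall y \near chart p q,
    ((chart (f p) \o cinv (f q)) \o (loc f q \o (chart q \o cinv p))) y =
    loc f p y.
  have A : nbhs q (dom q `&` f @^-1` dom (f q)).
    by apply: filterI; [exact: nbhs_dom|apply: sf.1; exact: nbhs_dom].
  apply: filterS (near_cinv pq A) => y [_ yE [qy fqy]].
  by rewrite /loc /= [cinv q _]chartK// chartK.
have [_ ->] := chain_rule (erefl _) d12 d3 eqF.
by have /(congr1 (@^~ v)) := diff_comp d1 d2 => ->; rewrite /tmap /trans /loc /= E1 E2.
Qed.

End Charts.

(** * Coordinate fields and one-forms on a manifold *)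

Section ConstantFields.
Context {R : realType} {n : nat} {M : manifold R n}.

Lemma Ck_cst (V W : normedModType R) j (U : set V) (F : V -> W) (c : W) :
  open U -> (forall x, U x -> F x = c) -> Ck j U F.
Proof.
move=> oU; elim: j F c => [|j IH] F c Fc.
  move=> x Ux; apply/differentiable_continuous.
  apply: (diff_near_cst (c := c) 0 _).1.
  by apply: filterS (open_nbhs_nbhs (conj oU Ux)) => y /Fc.
have near_c x : U x -> \forall y \near x, F y = c.
  by move=> Ux; apply: filterS (open_nbhs_nbhs (conj oU Ux)) => y /Fc.
split=> [x Ux|v]; first exact: (diff_near_cst 0 (near_c x Ux)).1.
by apply: (IH _ 0) => x Ux; exact: (diff_near_cst v (near_c x Ux)).2.
Qed.

Lemma smooth_near_cst (V W : normedModType R) (F : V -> W) (c : W) x :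
  (\forall y \near x, F y = c) -> smooth_near F x.
Proof.
move=> Fc; exists ([set y | F y = c]^°); split; first exact: open_interior.
  exact: Fc.
move=> j; apply: Ck_cst; first exact: open_interior.
by move=> y Uy; exact: (interior_subset Uy).
Qed.

(** The field that is constant with value v in the chart at p; off the domain of
that chart its values are junk. *)
Definition cfield (p : M) (v : 'rV[R]_n) : vfield M := fun q => trans p q q v.

Lemma cfield_center p v : cfield p v p = v.
Proof.
have idE : \forall y \near chart p p, id y = (chart p \o cinv p) y.
  by apply: filterS (near_cinv (dom_center p) (nbhs_dom (dom_center p))) => y [_ yE _].
have /(_ (chart p p)) [did idv] := @is_diff_id R 'rV[R]_n.
rewrite /cfield /trans.
by have /(congr1 (@^~ v)) := near_eq_diff idE did => ->; exact: (congr1 (@^~ v) idv).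
Qed.

Lemma vrep_cfield p v :
  \forall y \near chart p p, vrep (cfield p v) p y = v.
Proof.
apply: filterS (near_cinv (dom_center p) (nbhs_dom (dom_center p))) => y [py _ _].
exact: (transK py (dom_center (cinv p y))).
Qed.

Lemma smooth_cfield p v : smooth_field_at (cfield p v) p.
Proof. exact/smooth_near_cst/vrep_cfield. Qed.

Lemma bracket_cfield p v w : bracket (cfield p v) (cfield p w) p = 0.
Proof.
have D u h : 'd (vrep (cfield p u) p) (chart p p) h = 0.
  exact: (diff_near_cst h (vrep_cfield p u)).2.
apply: etrans (subrr 0).
exact: (f_equal2 (fun a b => a - b) (D w _) (D v _)).
Qed.

Definition form_rep (a : M -> {scalar 'rV[R]_n}) (p : M) (y : 'rV[R]_n) :
    {scalar 'rV[R]_n} :=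
  let q := cinv p y in (a q \o trans p q q : {scalar 'rV[R]_n}).

Definition smooth_form (a : M -> {scalar 'rV[R]_n}) : Prop :=
  forall p (X : vfield M), smooth_field_at X p ->
    smooth_fun_at (fun q => a q (X q)) p.

Lemma differentiable_form_rep a p : smooth_form a -> differentiable_form (form_rep a p) (chart p p).
Proof.
move=> sa u; have [U [_ Up /(_ 1%N)[dU _]]] := sa p _ (smooth_cfield p u).
exact: dU.
Qed.

(** The invariant formula for d a on coordinate fields, which commute; hence no
bracket term. *)
Lemma dform_rep a p v w :
  dform (form_rep a p) (chart p p) v w =
  dfun (fun q => a q (cfield p w q)) p v - dfun (fun q => a q (cfield p v q)) p w.
Proof. by []. Qed.

End ConstantFields.

(** * Pullback of a one-form to an integral manifold *)

Section Pullback.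
Context {R : realType} {n k : nat} {M : manifold R n} {N : manifold R k}.

Lemma loc_center (f : M -> N) p : loc f p (chart p p) = chart (f p) (f p).
Proof. by rewrite /loc /= chartK//; exact: dom_center. Qed.

Lemma loc_C2 (f : M -> N) p : smooth_map f ->
  (forall v, differentiable (fun z => 'd (loc f p) z v) (chart p p)) /\
  (forall v w, 'd (fun z => 'd (loc f p) z v) (chart p p) w =
               'd (fun z => 'd (loc f p) z w) (chart p p) v).
Proof.
move=> [_ /(_ p) [U [oU Up /(_ 2%N) C2]]]; split=> [v|v w].
  exact: (C2.2 v).1.
exact: (@diff_diff_sym _ _ _ U).
Qed.

End Pullback.

Section Integral.
Context {R : realType} {l n k : nat} {L : manifold R l} {M : manifold R n}
  {N : manifold R k}.

(** Read in charts, a form that vanishes on the vectors tangent to [f \o i] pulls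
back to zero near q0, so the exterior derivative of its pullback is zero;
by naturality, applied to f and then to i, this is the restriction of d a. *)
Lemma dform_integral (a : N -> {scalar 'rV[R]_k}) (i : L -> M) (f : M -> N) q0 :
  smooth_form a -> smooth_map i -> smooth_map f ->
  (forall q u, a (f (i q)) (tmap f (i q) (tmap i q u)) = 0) ->
  forall u w, dform (form_rep a (f (i q0))) (chart (f (i q0)) (f (i q0)))
    (tmap f (i q0) (tmap i q0 u)) (tmap f (i q0) (tmap i q0 w)) = 0.
Proof.
move=> sa si sf af0 u w.
set p := i q0; set P := f p.
pose A := form_rep a P; pose B := form_pull (loc f p) A; pose C := form_pull (loc i q0) B.
have dA : differentiable_form A (loc f p (chart p p)).
  by rewrite loc_center; exact: differentiable_form_rep.
have [ddf symf] := loc_C2 p sf.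
have [ddi symi] := loc_C2 q0 si.
have dF := loc_differentiable p sf.
have dG := loc_differentiable q0 si.
have dB : differentiable_form B (loc i q0 (chart q0 q0)).
  by rewrite loc_center; exact: differentiable_form_pull.
have C0 v : \forall x \near chart q0 q0, (C x v : R) = 0.
  have nb : nbhs q0 (dom q0 `&` (i @^-1` dom p `&` (f \o i) @^-1` dom P)).
    apply: filterI; first exact/nbhs_dom/dom_center.
    apply: filterI; first by apply: si.1; exact/nbhs_dom/dom_center.
    apply: (continuous_comp (si.1 q0) (sf.1 (i q0))).
    exact/nbhs_dom/dom_center.
  apply: filterS (near_cinv (dom_center q0) nb) => x [_ xE [qq [pq Pq]]].
  move: qq pq Pq; set q := cinv q0 x => qq pq Pq.
  have GE : loc i q0 x = chart p (i q) by [].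
  have FE : loc f p (chart p (i q)) = chart P (f (i q)).
    by rewrite /loc /= chartK.
  (* The vector is carried to the chart at q, pushed forward by i and f, and
     carried back: the four changes of charts cancel. *)
  rewrite /C /form_pull /= GE -xE -/q (diff_loc _ si qq pq).
  rewrite /B /form_pull /= FE (diff_loc _ sf pq Pq) (transK (dom_center _) pq).
  rewrite /A /form_rep /= [cinv P _]chartK//.
  by rewrite (transK (dom_center _) Pq) af0.
have dC : dform C (chart q0 q0) u w = 0.
  have D v h : 'd (fun x => (C x v : R)) (chart q0 q0) h = 0.
    exact: (diff_near_cst h (C0 v)).2.
  apply: etrans (subrr 0).
  exact: (f_equal2 (fun a b => a - b) (D w u) (D u w)).
have := dform_pull dG ddi (symi u w) dB.
rewrite dC loc_center => /esym; rewrite (dform_pull dF ddf (symf _ _) dA) loc_center.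
exact.
Qed.
End Integral.

(** * Orthogonal projection *)

Section InnerProduct.
Context {R : realType} {n : nat} (G : 'rV[R]_n -> 'rV[R]_n -> R).
Context (G_linear : forall w a u v, G (a *: u + v) w = a * G u w + G v w)
  (G_sym : forall u v, G u v = G v u) (G_pos : forall u, u != 0 -> 0 < G u u).

Lemma inner0l w : G 0 w = 0.
Proof.
have := G_linear w 1 0 0; rewrite scale1r addr0 mul1r => /esym/eqP.
by rewrite -subr_eq0 addrK => /eqP.
Qed.

Lemma inner0r w : G w 0 = 0. Proof. by rewrite G_sym inner0l. Qed.

Lemma innerZl a u w : G (a *: u) w = a * G u w.
Proof. by rewrite -[a *: u]addr0 G_linear inner0l addr0. Qed.

Lemma innerDl u v w : G (u + v) w = G u w + G v w.
Proof. by rewrite -[u]scale1r G_linear scale1r mul1r. Qed.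

Lemma innerDr u v w : G w (u + v) = G w u + G w v.
Proof. by rewrite !(G_sym w) innerDl. Qed.

Lemma innerZr a u w : G w (a *: u) = a * G w u.
Proof. by rewrite !(G_sym w) innerZl. Qed.

Lemma innerNl u w : G (- u) w = - G u w.
Proof. by rewrite -scaleN1r innerZl mulN1r. Qed.

Lemma innerBl u v w : G (u - v) w = G u w - G v w.
Proof. by rewrite innerDl innerNl. Qed.

Lemma inner_eq0 u : G u u = 0 -> u = 0.
Proof. by move=> Gu; apply/eqP/negPn/negP => /G_pos; rewrite Gu ltxx. Qed.

(** Gram-Schmidt, by induction on a basis of U. *)
Lemma orthogonal_projection (U : {vspace 'rV[R]_n}) w :
  exists2 u, u \in U & forall e, e \in U -> G (w - u) e = 0.
Proof.
rewrite -(span_basis (vbasisP U)); move: (tval (vbasis U)) w => xs {U}.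
elim: xs => [|x xs IH] w.
  exists 0; first by rewrite mem0v.
  by move=> e; rewrite span_nil memv0 => /eqP ->; rewrite inner0r.
have [u0 u0s x_orth] := IH x; have [u1 u1s w_orth] := IH w.
set x' := x - u0 in x_orth; set w' := w - u1 in w_orth.
(* If x' = 0 the coefficient is the junk value 0, which is harmless. *)
pose c := G w' x' / G x' x'.
have x_span : x \in <<x :: xs>>%VS by rewrite memv_span// mem_head.
have s_span e : e \in <<xs>>%VS -> e \in <<x :: xs>>%VS.
  by apply/subvP; rewrite span_cons addvSr.
have cE : G w' x' - c * G x' x' = 0.
  have [x0|x0] := eqVneq x' 0; first by rewrite x0 !inner0r mulr0 subrr.
  by rewrite /c divfK ?subrr// gt_eqF// G_pos.
exists (u1 + c *: x').
  by rewrite rpredD ?rpredZ ?rpredB// s_span.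
move=> e; rewrite span_cons => /memv_addP[_ /vlineP[a ->] [e' e's ->]].
have xE : x = x' + u0 by rewrite subrK.
have Gxs t : t \in <<xs>>%VS -> G (w' - c *: x') t = 0.
  by move=> ts; rewrite innerBl innerZl w_orth// x_orth// mulr0 subrr.
rewrite opprD addrA -/w' innerDr innerZr (Gxs e')// xE innerDr (Gxs u0)//.
by rewrite innerBl innerZl cE !addr0 mulr0.
Qed.

End InnerProduct.

(** * The exterior derivative of the contact form *)

Section Sasakian.
Context {R : realType} {k : nat} {N : manifold R k} (S : sasakian N).
Implicit Types (p : N) (u v w : 'rV[R]_k).

Let gl p := Defs.metric_linear (g_metric S) p.
Let gs p := Defs.metric_sym (g_metric S) p.

Lemma eta_g p u : eta S p u = g S p u (xi S p).
Proof.
have := g_phi S p u (xi S p).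
by rewrite phi_xi eta_xi mulr1 (inner0r (gl p) (gs p)) => /esym/subr0_eq.
Qed.

(** phi^3 u is computed in two ways, applying phi^2 = - 1 + eta xi first to u or
first to phi u. *)
Lemma eta_phi p u : eta S p (phi S p u) = 0.
Proof.
have := phi_phi S p (phi S p u).
rewrite (phi_phi S p u) linearD linearN linearZ/= phi_xi scaler0 addr0 => /esym/eqP.
rewrite -subr_eq0 addrAC subrr add0r => /eqP /(congr1 (eta S p)).
by rewrite linearZ/= eta_xi mulr1 linear0.
Qed.

Lemma g_phi_skew p u v : g S p (phi S p u) v = - g S p u (phi S p v).
Proof.
have := g_phi S p (phi S p u) v.
rewrite eta_phi mul0r subr0 => <-.
rewrite phi_phi (innerDl (gl p)) (innerNl (gl p)) (innerZl (gl p)).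
by rewrite gs -[_ (xi S p) _]gs -eta_g eta_phi mulr0 addr0 gs.
Qed.

(** The Sasakian condition at Y = xi, where phi Y is the zero field. *)
Lemma phi_nabla_xi p v :
  phi S p (nabla S (xi S) p v) = v - eta S p v *: xi S p.
Proof.
have LC := nabla_levi_civita S.
have phixi : (fun q => phi S q (xi S q)) = (fun=> 0).
  by apply/funext => q; rewrite phi_xi.
have s0 : smooth_field_at (fun=> 0 : 'rV[R]_k) p.
  by have := phi_smooth S (xi_smooth S p); rewrite phixi.
have nabla0 : nabla S (fun=> 0) p v = 0.
  have := nabla_add LC v s0 s0.
  rewrite (_ : (fun q => _) = (fun=> 0)); last by apply/funext => q; rewrite addr0.
  by move/eqP; rewrite -subr_eq0 opprD addrA subrr sub0r oppr_eq0 => /eqP.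
have := nabla_phi S v (xi_smooth S p).
rewrite phixi nabla0 sub0r eta_xi scale1r -eta_g => /(congr1 -%R).
by rewrite opprK opprB.
Qed.

(** Applying phi to [phi_nabla_xi] gives nabla_v xi = - phi v modulo xi, and w
is orthogonal to xi. *)
Lemma g_nabla_xi p v w : eta S p w = 0 ->
  g S p (nabla S (xi S) p v) w = - g S p (phi S p v) w.
Proof.
move=> w0; have := congr1 (phi S p) (phi_nabla_xi p v).
rewrite phi_phi linearB linearZ/= phi_xi scaler0 subr0 => <-.
rewrite (innerDl (gl p)) (innerNl (gl p)) (innerZl (gl p)).
by rewrite [_ (xi S p) _]gs -eta_g w0 mulr0 addr0 opprK.
Qed.

(** For coordinate fields X and Y, the terms of X eta(Y) - Y eta(X) in which a
covariant derivative hits X or Y add up to eta([X, Y]) = 0. *)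
Lemma d_eta p v w : eta S p v = 0 -> eta S p w = 0 ->
  dform (form_rep (eta S) p) (chart p p) v w = - (g S p (phi S p v) w) *+ 2.
Proof.
move=> v0 w0; rewrite dform_rep.
have LC := nabla_levi_civita S.
have E u t : dfun (fun q => eta S q (cfield p u q)) p t =
    g S p (nabla S (cfield p u) p t) (xi S p) + g S p u (nabla S (xi S) p t).
  have := nabla_metric LC t (smooth_cfield p u) (xi_smooth S p).
  rewrite cfield_center => <-.
  by congr (dfun _ p t); apply/funext => q; rewrite eta_g.
rewrite (E w v) (E v w).
have := nabla_torsion_free LC (smooth_cfield p v) (smooth_cfield p w).
rewrite bracket_cfield !cfield_center => /eqP; rewrite subr_eq0 => /eqP ->.
rewrite !(gs p _ (nabla S (xi S) p _)) !g_nabla_xi//.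
rewrite opprD addrACA subrr add0r opprK [g S p (phi S p w) v]g_phi_skew.
by rewrite (gs p w) mulr2n.
Qed.

End Sasakian.

(** * The ambiguous distribution of a maximal PTR structure *)

Section PTR.
Context {R : realType} {k n : nat} {N : manifold R k} {M : manifold R n}.
Context (S : sasakian N) (f : M -> N) (Dperp : M -> {vspace 'rV[R]_n}).
Let gl p := Defs.metric_linear (g_metric S) p.
Let gs p := Defs.metric_sym (g_metric S) p.
Let gp p := @Defs.metric_pos _ _ _ _ (g_metric S) p.

Lemma tmap_eq0 p v : immersion f -> tmap f p v = 0 -> v = 0.
Proof. by move=> [_ /(_ p) inj] v0; apply: inj; rewrite v0 /tmap linear0. Qed.

Lemma Pmap_eq0 p v : immersion f ->
  is_normal S f p (phi S (f p) (tmap f p v)) -> Pmap S f p v = 0.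
Proof.
move=> imf nor; rewrite /Pmap /tangent_part; case: xgetP => // w _ /= wnor.
apply: (tmap_eq0 imf); apply: (inner_eq0 (@gp (f p))).
by apply: oppr_inj; rewrite oppr0 -[RHS](wnor w) (innerBl (gl (f p))) (nor w) sub0r.
Qed.

Lemma ambiguous0 p : ambiguous S f Dperp p 0.
Proof.
by rewrite /ambiguous /= /tmap linear0 (inner0l (gl (f p))); split=> // w _;
  rewrite (inner0l (gl (f p))).
Qed.

(** Orthogonal projection onto D^perp + <xi>, for the metric induced on M. *)
Lemma tangent_split p w : immersion f -> xi_tangent S f ->
  exists d e z, [/\ w = d + (e + z), ambiguous S f Dperp p d, e \in Dperp p &
     exists c, tmap f p z = c *: xi S (f p)].
Proof.
move=> imf /(_ p)[x xE].
pose G u v := g S (f p) (tmap f p u) (tmap f p v).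
have Gl t a u v : G (a *: u + v) t = a * G u t + G v t.
  by rewrite /G /tmap linearP gl.
have Gs u v : G u v = G v u by rewrite /G gs.
have Gp u : u != 0 -> 0 < G u u.
  by move=> u0; apply: gp; apply: contra_neq u0; exact: tmap_eq0.
have [u /memv_addP[e eD [z /vlineP[c zE] uE]] orth] :=
  orthogonal_projection Gl Gs Gp (Dperp p + <[x]>)%VS w.
exists (w - u), e, z; split => //; first by rewrite -uE subrK.
  split; first by rewrite -xE; apply: orth; exact: (subvP (addvSr _ _)) (memv_line _).
  by move=> t tD; apply: orth; exact: (subvP (addvSl _ _)).
by exists c; rewrite zE /tmap linearZ -xE.
Qed.

(** Under the hypothesis on v the vector phi v is normal to M, so by maximality
v lies in D^perp, to which it is orthogonal. *)
Lemma ambiguous_not_isotropic p v :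
  ptr_submanifold S f Dperp -> ptr_maximal S f Dperp ->
  ambiguous S f Dperp p v ->
  (forall w, ambiguous S f Dperp p w ->
     g S (f p) (phi S (f p) (tmap f p v)) (tmap f p w) = 0) ->
  v = 0.
Proof.
move=> ptr mx [vxi vD] iso.
have imf := ptr_immersion ptr.
have nor : is_normal S f p (phi S (f p) (tmap f p v)).
  move=> w; have [d [e [z [-> dA eD [c zE]]]]] :=
    tangent_split p w imf (ptr_xi_tangent ptr).
  have tD a b : tmap f p (a + b) = tmap f p a + tmap f p b by rewrite /tmap linearD.
  rewrite !tD zE !(innerDr (gl (f p)) (gs (f p))) (innerZr (gl (f p)) (gs (f p))).
  rewrite iso// -eta_g eta_phi g_phi_skew gs (ptr_totally_real ptr eD).
  by rewrite oppr0 mulr0 !addr0.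
have vDp : v \in Dperp p.
  by apply/mx; split; [rewrite /horizontal eta_g|exact: Pmap_eq0].
apply: (tmap_eq0 (p := p) imf); apply: (inner_eq0 (@gp (f p))); exact: vD.
Qed.

End PTR.

Theorem corollary3p5 (R : realType) (m n : nat)
    (N : manifold R (2 * m).+1) (S : sasakian N)
    (M : manifold R n) (f : M -> N) (Dperp : M -> {vspace 'rV[R]_n}) :
  ptr_submanifold S f Dperp ->
  ptr_maximal S f Dperp ->
  (exists p : M, ambiguous S f Dperp p <> [set 0]) ->
  ~ integrable_distribution (ambiguous S f Dperp).
Proof.
move=> ptr mx [p Dp] /(_ p) [l [L [i [q0 [imi _ ip rng]]]]].
apply: Dp; apply/seteqP; split => v /=; last by move=> ->; exact: ambiguous0.
move=> vA; apply: (ambiguous_not_isotropic ptr mx vA) => w wA.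
subst p.
have : range (tmap i q0) v by rewrite rng.
have : range (tmap i q0) w by rewrite rng.
move=> [w' _ wE] [v' _ vE].
have hor q u : ambiguous S f Dperp q u -> eta S (f q) (tmap f q u) = 0.
  by move=> [+ _]; rewrite eta_g.
have := @dform_integral _ _ _ _ _ _ _ (eta S) i f q0 (eta_smooth S)
  imi.1 (ptr_immersion ptr).1.
move=> /(_ _ v' w'); rewrite wE vE d_eta ?hor// => H.
have /eqP : - g S (f (i q0)) (phi S (f (i q0)) (tmap f (i q0) v)) (tmap f (i q0) w) *+ 2 = 0.
  by apply: H => q u; apply: hor; rewrite -rng; exists u.
by rewrite mulrn_eq0/= oppr_eq0 => /eqP.
Qed.
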